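(* Let $z$ be an indeterminate and let $(N_{n,k}(z))$ be defined by $N_{0,0}=1$, $N_{0,k}=0$ ($k>0$), and for $n\ge1$, $N_{n,k}=N_{n-1,k-1}+(z+1)N_{n-1,k}+zN_{n-1,k+1}$ for all $k\ge0$ (with $N_{n-1,-1}=0$); let $N_n(z)=N_{n,0}(z)$. For integers $m,n\ge0$ define $$F_{m,n}(z)=\sum_{k=0}^{n}(-z)^k\det\begin{pmatrix}N_{n,k}(z)&N_{n,k+1}(z)\\ N_{m,k}(z)&N_{m,k+1}(z)\end{pmatrix}.$$ Then for all $m\ge1$, $n\ge0$, $F_{m,n}(z)=2(z+1)F_{m-1,n}(z)-F_{m-1,n+1}(z)$; moreover $F_{n,n}(z)=0$ and $F_{n+1,n}(z)=N_n(z^2)$ for all $n\ge0$; and for all $m>n\ge0$, $$F_{m,n}(z)=\sum_{j=0}^{\lfloor\frac{m-n-1}{2}\rfloor}(-1)^j\binom{m-n-1-j}{j}N_{n+j}(z^2)\big(2(z+1)\big)^{m-n-1-2j}.$$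
   Context: Explicitly, $N_n(z)=\sum_{i=0}^{n}\frac{1}{n+1}\binom{n+1}{i}\binom{n+1}{i+1}z^i$ (Narayana polynomials). *)

(* Defs.v *)
From mathcomp Require Import all_boot all_order all_algebra.

Set Implicit Arguments.
Unset Strict Implicit.
Unset Printing Implicit Defensive.

Import GRing.Theory.
Local Open Scope ring_scope.

(* The indeterminate z is 'X in {poly int}. *)

Fixpoint narayana_tri (n k : nat) : {poly int} :=
  match n with
  | 0 => (k == 0%N)%:R
  | n'.+1 =>
      (if k is k'.+1 then narayana_tri n' k' else 0)
      + ('X + 1) * narayana_tri n' k + 'X * narayana_tri n' k.+1
  end.

Definition narayana (n : nat) : {poly int} := narayana_tri n 0.

Definition narayana_minor (m n k : nat) : 'M[{poly int}]_2 :=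
  \matrix_(i < 2, j < 2) narayana_tri (if i == ord0 then n else m) (k + j)%N.

Definition Fsum (m n : nat) : {poly int} :=
  \sum_(0 <= k < n.+1) (- 'X) ^+ k * \det (narayana_minor m n k).

(* Main.v *)
Require Import Defs.
From mathcomp Require Import all_boot all_order all_algebra.
From mathcomp Require Import zify ring.

Import GRing.Theory.
Local Open Scope ring_scope.

(** Put s = z + 1, let Y be the operator (Y a)_k = a_{k-1} + z a_{k+1} on
    sequences and J = s + Y, so that row n of the triangle is J^n e_0.  A
    telescoping sum gives F_{m+1,n} + F_{m,n+1} = 2 s F_{m,n}, and
    F_{m,0} = (J^m e_0)_1, hence F_{m,n} = (J^m (2s - J)^n e_0)_1.  In particular
    F_{n+1,n} = ((s + Y) (s^2 - Y^2)^n e_0)_1.  The operator s^2 - Y^2 preserves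
    parity, so only the part Y (s^2 - Y^2)^n e_0 contributes, and on sequences
    supported on the odd indices, after the change of signs
    b_j = (-1)^j a_{2j+1}, the operator s^2 - Y^2 is J with z replaced by z^2.
    The closed formula follows from the recurrence in m - n and Pascal's rule. *)

(** Past d/2 one has d - j < j, so the binomial vanishes. The full range spares the induction a case
    split on the parity of d. *)
Lemma sum_half_binomial (R : comPzRingType) (t : R) (b : nat -> R) (d : nat) :
  \sum_(0 <= j < d./2.+1) (-1) ^+ j * 'C(d - j, j)%:R * b j * t ^+ (d - 2 * j)
  = \sum_(j < d.+1) (-1) ^+ j * 'C(d - j, j)%:R * b j * t ^+ (d - 2 * j).
Proof.
rewrite -(big_mkord xpredT
  (fun j => (-1) ^+ j * 'C(d - j, j)%:R * b j * t ^+ (d - 2 * j))).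
rewrite [RHS](@big_cat_nat _ _ _ d./2.+1) //=; last by lia.
rewrite [X in _ + X]big_nat_cond [X in _ + X]big1 ?addr0 // => j.
rewrite andbT => /andP[hj _]; rewrite bin_small ?mulr0 ?mul0r //; lia.
Qed.

Lemma lucas_recurrence_solution (R : comPzRingType) (t : R)
    (a : nat -> nat -> R) :
  (forall n, a n 1%N = t * a n 0%N) ->
  (forall n d, a n d.+2 = t * a n d.+1 - a n.+1 d) ->
  forall d n, a n d =
    \sum_(0 <= j < d./2.+1)
      (-1) ^+ j * 'C(d - j, j)%:R * a (n + j)%N 0%N * t ^+ (d - 2 * j).
Proof.
move=> a1 aSS d n; rewrite sum_half_binomial.
elim/ltn_ind: d n => -[|[|d]] IH n.
- by rewrite big_ord1 addn0 bin0 !expr0 !mul1r mulr1.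
- by rewrite big_ord_recl big_ord1 addn0 /= a1 bin0 bin_small //; ring.
rewrite aSS !IH //; try lia.
rewrite big_ord_recl [RHS]big_ord_recl [in RHS]big_ord_recr /=.
rewrite [X in _ = _ + (_ + X)](_ : _ = 0); last first.
  by rewrite bin_small ?mulr0 ?mul0r //; rewrite /bump /=; lia.
rewrite addr0 mulrDr -addrA; congr (_ + _).
  by rewrite !bin0 !muln0 !subn0 [t ^+ d.+2]exprS; ring.
rewrite mulr_sumr -sumrB; apply: eq_bigr => i _ /=.
rewrite /bump /= !add1n.
have hi : (i <= d)%N by rewrite -ltnS.
have -> : (d.+2 - 2 * i.+1 = d - 2 * i)%N by lia.
have -> : (d.+2 - i.+1 = (d - i).+1)%N by lia.
rewrite subSS binS natrD addnS addSn [(-1) ^+ i.+1]exprS.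
(* For d <= 2i the exponent d + 1 - 2(i + 1) is truncated, but its coefficient C(d - i, i + 1) is
   zero. *)
have [h|h] := ltnP d (2 * i).+1.
  by rewrite (@bin_small (d - i) i.+1) ?mulr0; [ring|lia].
have -> : (d - 2 * i = (d.+1 - 2 * i.+1).+1)%N by lia.
by rewrite [t ^+ _.+1]exprS; ring.
Qed.

Lemma narayana_tri_gt (n k : nat) : (n < k)%N -> narayana_tri n k = 0.
Proof.
elim: n k => [|n IH] [|k] //= nk.
by rewrite !IH ?mulr0 ?addr0 //; lia.
Qed.

Lemma det_narayana_minor (m n k : nat) :
  \det (narayana_minor m n k) =
  narayana_tri n k * narayana_tri m k.+1 - narayana_tri n k.+1 * narayana_tri m k.
Proof.
rewrite (expand_det_row _ ord0) !big_ord_recl big_ord0 /cofactor !det_mx11 !mxE /=.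
by rewrite addn0 addn1; ring.
Qed.

Lemma Fsum_extend (m n d : nat) :
  Fsum m n = \sum_(0 <= k < n.+1 + d) (- 'X) ^+ k * \det (narayana_minor m n k).
Proof.
rewrite /Fsum [RHS](@big_cat_nat _ _ _ n.+1) ?leq_addr //=.
rewrite [X in _ + X]big_nat_cond [X in _ + X]big1 ?addr0 // => k.
rewrite andbT => /andP[hk _]; rewrite det_narayana_minor.
by rewrite !(@narayana_tri_gt n) ?mul0r ?subr0 ?mulr0 //; lia.
Qed.

Lemma Fsum_recurrence (m n : nat) :
  Fsum m.+1 n = 2 * ('X + 1) * Fsum m n - Fsum m n.+1.
Proof.
apply/eqP; rewrite -subr_eq0; apply/eqP.
rewrite (Fsum_extend m.+1 n 1) (Fsum_extend m n 1) /Fsum addn1.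
(* [E k] is the minor on columns k - 1 and k + 1. The s-terms cancel, and the summand of F_{m+1,n} +
   F_{m,n+1} - 2s F_{m,n} becomes (-z)^k (E_k + z E_{k+1}). *)
pose E k := if k is k'.+1 then
  narayana_tri n k' * narayana_tri m k.+1 - narayana_tri n k.+1 * narayana_tri m k'
  else 0.
have tele K : \sum_(0 <= k < K) ((- 'X) ^+ k * E k - (- 'X) ^+ k.+1 * E k.+1)
    = - ((- 'X) ^+ K * E K).
  elim: K => [|K IH]; first by rewrite big_nil /E mulr0 oppr0.
  by rewrite big_nat_recr //= IH; ring.
transitivity (- ((- 'X) ^+ n.+2 * E n.+2)); last first.
  by rewrite /E !(@narayana_tri_gt n) ?mul0r ?subr0 ?mulr0 ?oppr0 //; lia.
rewrite -tele mulr_sumr opprB addrC -!sumrN -!big_split /=; apply: eq_bigr => k _.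
by rewrite !det_narayana_minor; case: k => [|k] /=; rewrite ?exprS /=; ring.
Qed.

Lemma Fsum_diag (n : nat) : Fsum n n = 0.
Proof.
by rewrite /Fsum big1 // => k _; rewrite det_narayana_minor; ring.
Qed.

(* [reflected_tri m n] is the sequence J^m (2s - J)^n e_0. *)
Fixpoint reflected_tri (m n k : nat) : {poly int} :=
  if n is n'.+1 then
    2 * ('X + 1) * reflected_tri m n' k - reflected_tri m.+1 n' k
  else narayana_tri m k.

(** J commutes with 2s - J. *)
Lemma reflected_triSl (m n k : nat) :
  reflected_tri m.+1 n k =
  (if k is k'.+1 then reflected_tri m n k' else 0)
  + ('X + 1) * reflected_tri m n k + 'X * reflected_tri m n k.+1.
Proof.
elim: n m k => [//|n IH] m k /=.
by rewrite (IH m.+1) (IH m k); case: k => [|k]; ring.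
Qed.

Lemma Fsum_reflected_tri (m n : nat) : Fsum m n = reflected_tri m n 1.
Proof.
elim: n m => [|n IH] m.
  by rewrite /Fsum big_nat1 det_narayana_minor /= expr0; ring.
by rewrite /= -!IH Fsum_recurrence; ring.
Qed.

(* The factorization (2s - J) J = s^2 - Y^2. *)
Lemma reflected_tri_diagS (n k : nat) (D := reflected_tri n n)
    (Y := fun k => (if k is k'.+1 then D k' else 0) + 'X * D k.+1) :
  reflected_tri n.+1 n.+1 k =
  ('X + 1) ^+ 2 * D k - ((if k is k'.+1 then Y k' else 0) + 'X * Y k.+1).
Proof.
rewrite [LHS]/= (reflected_triSl n.+1 n k) {}/Y {}/D.
case: k => [|k]; rewrite !(reflected_triSl n n); first by ring.
by case: k => [|k]; ring.
Qed.

Lemma reflected_tri_diag_odd (n j : nat) : reflected_tri n n j.*2.+1 = 0.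
Proof.
elim: n j => [//|n IH] j; rewrite reflected_tri_diagS.
have D1 := IH j; have D3 := IH j.+1; rewrite !doubleS in D1 D3 *.
rewrite D1 D3; case: j {D1 D3} => [|j]; first by rewrite double0; ring.
by rewrite doubleS IH; ring.
Qed.

(** The left side is entry 2j + 1 of Y (s^2 - Y^2)^n e_0. On odd indices Y^2 has diagonal
    coefficient 2z, even at index 1, and s^2 - 2z = z^2 + 1. *)
Lemma reflected_tri_diag_even (n j : nat) :
  reflected_tri n n j.*2 + 'X * reflected_tri n n j.*2.+2 =
  (-1) ^+ j * (narayana_tri n j \Po 'X^2).
Proof.
elim: n j => [|n IH] j.
  case: j => [|j] /=; first by rewrite comp_polyC; ring.
  by rewrite comp_polyC; ring.
rewrite [narayana_tri _ _]/= !(comp_polyD, comp_polyM) comp_polyX.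
rewrite !reflected_tri_diagS (_ : 1 \Po 'X^2 = 1 :> {poly int}); last first.
  by rewrite comp_polyC.
have IHj := IH j; have IHS := IH j.+1; rewrite !doubleS in IHj IHS *.
rewrite IHj IHS.
(* Solved for its lower entry, the hypothesis lets [ring] eliminate that entry. *)
have {}IHj : reflected_tri n n j.*2 =
    (-1) ^+ j * (narayana_tri n j \Po 'X^2) - 'X * reflected_tri n n j.*2.+2.
  by rewrite -IHj; ring.
case: j IHj {IHS} => [|j] IHj.
  by rewrite comp_poly0 /= in IHj *; rewrite IHj; ring.
have IHp := IH j; rewrite !doubleS in IHj *.
rewrite IHp IHj !exprS; ring.
Qed.

Lemma Fsum_subdiag (n : nat) : Fsum n.+1 n = narayana n \Po 'X^2.
Proof.
rewrite Fsum_reflected_tri reflected_triSl (reflected_tri_diag_odd n 0) mulr0.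
by rewrite addr0 (reflected_tri_diag_even n 0) mul1r.
Qed.

Theorem theorem3p5 :
  [/\ forall m n : nat, (1 <= m)%N ->
        Fsum m n = 2 * ('X + 1) * Fsum m.-1 n - Fsum m.-1 n.+1,
      forall n : nat, Fsum n n = 0,
      forall n : nat, Fsum n.+1 n = narayana n \Po 'X^2
    & forall m n : nat, (n < m)%N ->
        Fsum m n =
          \sum_(0 <= j < (m - n - 1)./2.+1)
            (-1) ^+ j * 'C(m - n - 1 - j, j)%:R * (narayana (n + j) \Po 'X^2)
              * (2 * ('X + 1)) ^+ (m - n - 1 - 2 * j)].
Proof.
split; [|exact: Fsum_diag|exact: Fsum_subdiag|].
  by case=> // m n _; exact: Fsum_recurrence.
move=> m n nm; rewrite -subnDA addn1.
(* With d = m - n - 1, the term F_{m-1,n+1} of the recurrence has offset d - 2. *)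
pose a n d := Fsum (n + d).+1 n.
have -> : Fsum m n = a n (m - n.+1)%N by rewrite /a -addSn subnKC.
rewrite (lucas_recurrence_solution _ (2 * ('X + 1)) a) => [|k|k d].
- by apply: eq_bigr => j _; rewrite /a addn0 Fsum_subdiag.
- by rewrite /a addn1 addn0 Fsum_recurrence Fsum_diag subr0.
- by rewrite /a !addnS Fsum_recurrence addSn.
Qed.
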